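(* Let $B$ be an algebra, let $\Gamma(B)=\Omega(B)/J(B)$ be a differential calculus over $B$, where $J(B)$ is a differential ideal of the universal differential calculus $\Omega(B)$, and let $(J_i)_{i\in I}$ be a covering of $B$. Put $B_i=B/J_i$ with quotient maps $\pi_i:B\to B_i$, and let $\pi_{i_\Omega}:\Omega(B)\to\Omega(B_i)$ be the extension of $\pi_i$ to the universal differential calculi. Then the pair $\bigl(\Gamma(B),(\Omega(B_i)/\pi_{i_\Omega}(J(B)))_{i\in I}\bigr)$ is adapted to $(B,(J_i)_{i\in I})$ if and only if $$J(B)=\bigcap_{i\in I}\bigl(J(B)+\ker\pi_{i_\Omega}\bigr).$$
   Context: Algebras are associative unital algebras over $\mathbb{C}$; ideals are two-sided. A finite family of ideals of an algebra is a covering of it if their intersection is $\{0\}$. A differential algebra over $B$ is an $\mathbb{N}$-graded algebra $\Gamma(B)=\bigoplus_{n\ge0}\Gamma^n(B)$ with $\Gamma^0(B)=B$ and a linear map $d$ with $d\Gamma^n(B)\subset\Gamma^{n+1}(B)$, $d(\rho\eta)=(d\rho)\eta+(-1)^n\rho\, d\eta$ for $\rho\in\Gamma^n(B)$, and $d^2=0$. It is a differential calculus if every element of $\Gamma^n(B)$ is a finite sum of elements $a_0\,da_1\cdots da_n$ with $a_k\in B$. A differential ideal is an ideal $J$ stable under $d$ and under the projections onto the homogeneous components. $\Omega(B)$ is the universal differential calculus over $B$; every differential calculus over $B$ is of the form $\Omega(B)/J(B)$ for a unique differential ideal $J(B)$ (whose degree-zero component is $0$). Every algebra homomorphism $\Psi:A\to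 B$ extends uniquely to a homomorphism (degree-preserving algebra homomorphism commuting with $d$) $\Psi_\Omega:\Omega(A)\to\Omega(B)$, $a_0da_1\cdots da_n\mapsto\Psi(a_0)d\Psi(a_1)\cdots d\Psi(a_n)$. $\Psi$ is differentiable with respect to differential calculi $\Gamma(A),\Gamma(B)$ if it extends to a homomorphism of differential algebras $\Psi_\Gamma:\Gamma(A)\to\Gamma(B)$. A pair $(\Gamma(B),(\Gamma(B_i))_{i\in I})$ of differential calculi over $B$ and $B_i=B/J_i$ is adapted to $(B,(J_i)_{i\in I})$ if all $\pi_i$ are differentiable and $\bigcap_i\ker\pi_{i_\Gamma}=\{0\}$. *)

(* Defs.v *)
From HB Require Import structures.
From mathcomp Require Import all_boot all_algebra.
From mathcomp Require Import boolp classical_sets reals.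
From mathcomp Require Import complex.

Set Implicit Arguments.
Unset Strict Implicit.
Unset Printing Implicit Defensive.

Import GRing.Theory.
Local Open Scope ring_scope.
Local Open Scope quotient_scope.
Local Open Scope classical_set_scope.

(* Unital associative algebras over K.  The library's [algType K] excludes the
   zero algebra, which occurs here (B / J_i with J_i = B), and its hierarchy has
   no join of [pzRingType] and [lmodType K]; hence a separate structure, with
   the usual algebra axioms. *)
HB.mixin Record isPzAlgebra (K : pzRingType) A of GRing.PzRing A := {
  ascale : K -> A -> A;
  ascaleA : forall b c x, ascale b (ascale c x) = ascale (b * c) x;
  ascale1 : forall x, ascale 1 x = x;
  ascaleDr : forall c x y, ascale c (x + y) = ascale c x + ascale c y;
  ascaleDl : forall b c x, ascale (b + c) x = ascale b x + ascale c x;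
  ascaleAl : forall c x y, ascale c (x * y) = ascale c x * y;
  ascaleAr : forall c x y, ascale c (x * y) = x * ascale c y
}.

#[short(type="pzAlgType")]
HB.structure Definition PzAlgebra (K : pzRingType) :=
  {A of GRing.PzRing A & isPzAlgebra K A}.

Notation "c *:: x" := (ascale c x) (at level 40) : ring_scope.

HB.mixin Record isAlgScalable (K : pzRingType) (A B : pzAlgType K)
    (f : A -> B) := {
  lhomZ : forall c x, f (c *:: x) = c *:: f x
}.

HB.structure Definition LinMap (K : pzRingType) (A B : pzAlgType K) :=
  {f of GRing.isZmodMorphism A B f & isAlgScalable K A B f}.

HB.structure Definition AlgHom (K : pzRingType) (A B : pzAlgType K) :=
  {f of @GRing.RMorphism A B f & isAlgScalable K A B f}.

Notation "{ 'linmap' A -> B }" := (LinMap.type A B)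
  (at level 0, A at level 98, B at level 99, format "{ 'linmap'  A  ->  B }").
Notation "{ 'alghom' A -> B }" := (AlgHom.type A B)
  (at level 0, A at level 98, B at level 99, format "{ 'alghom'  A  ->  B }").


Section AlgHomComp.
Variables (K : pzRingType) (A B C : pzAlgType K).
Variables (g : {alghom B -> C}) (f : {alghom A -> B}).
Let idZ c (x : A) : idfun (c *:: x) = c *:: idfun x. Proof. by []. Qed.
HB.instance Definition _ := isAlgScalable.Build K A A idfun idZ.
Let compZ c x : (g \o f) (c *:: x) = c *:: (g \o f) x.
Proof. by rewrite /= !lhomZ. Qed.
HB.instance Definition _ := isAlgScalable.Build K A C (g \o f) compZ.
End AlgHomComp.

Record ideal (K : pzRingType) (A : pzAlgType K) := Ideal {
  ideal_set :> A -> Prop;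
  ideal0 : ideal_set 0;
  idealD : forall x y, ideal_set x -> ideal_set y -> ideal_set (x + y);
  idealMl : forall a x, ideal_set x -> ideal_set (a * x);
  idealMr : forall a x, ideal_set x -> ideal_set (x * a)
}.

Section QuotientAlgebra.
Variables (K : pzRingType) (A : pzAlgType K) (I : ideal A).

Lemma idealN x : I x -> I (- x).
Proof. by move=> Ix; rewrite -mulN1r; apply: idealMl. Qed.

Lemma idealB x y : I x -> I y -> I (x - y).
Proof. by move=> Ix Iy; apply: idealD => //; apply: idealN. Qed.

Lemma idealZ c x : I x -> I (c *:: x).
Proof. by move=> Ix; rewrite -[x]mul1r ascaleAl; apply: idealMl. Qed.

Definition ideal_rel : rel A := fun x y => `[< I (x - y) >].

Lemma ideal_rel_equiv : equiv_class_of ideal_rel.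
Proof.
split=> [x|x y|y x z]; first by apply/asboolP; rewrite subrr; apply: ideal0.
- by apply: asbool_equiv_eq; split => /idealN; rewrite opprB.
- move=> /asboolP h1 /asboolP h2; apply/asboolP.
  by rewrite -(subrKA y); apply: idealD.
Qed.

Canonical ideal_equiv := EquivRelPack ideal_rel_equiv.
Canonical ideal_encModRel := defaultEncModRel ideal_rel.

Definition quot := {eq_quot ideal_rel}.
HB.instance Definition _ := Choice.on quot.
HB.instance Definition _ : EqQuotient A ideal_rel quot := EqQuotient.on quot.

Definition quot_pi (x : A) : quot := \pi_quot x.

Lemma quot_piP x y : quot_pi x = quot_pi y <-> I (x - y).
Proof.
split; first by move/eqquotP/asboolP.
by move=> h; apply/eqquotP/asboolP.
Qed.

Lemma quot_surj (u : quot) : exists x, quot_pi x = u.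
Proof. by exists (repr u); apply: reprK. Qed.

Lemma quot_reprB x : I (repr (quot_pi x) - x).
Proof. by apply/quot_piP; apply: reprK. Qed.

Definition qadd (u v : quot) := quot_pi (repr u + repr v).
Definition qopp (u : quot) := quot_pi (- repr u).
Definition qmul (u v : quot) := quot_pi (repr u * repr v).
Definition qscale (c : K) (u : quot) := quot_pi (c *:: repr u).

Lemma qaddE x y : qadd (quot_pi x) (quot_pi y) = quot_pi (x + y).
Proof.
apply/quot_piP; rewrite opprD addrACA.
by apply: idealD; apply: quot_reprB.
Qed.

Lemma qoppE x : qopp (quot_pi x) = quot_pi (- x).
Proof. by apply/quot_piP; rewrite -opprD; apply/idealN/quot_reprB. Qed.

Lemma qmulE x y : qmul (quot_pi x) (quot_pi y) = quot_pi (x * y).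
Proof.
apply/quot_piP; set x' := repr _; set y' := repr _.
rewrite -(subrKA (x * y')) -mulrBl -mulrBr.
by apply: idealD; [apply: idealMr|apply: idealMl]; apply: quot_reprB.
Qed.

Lemma ascaleN c (x : A) : c *:: (- x) = - (c *:: x).
Proof. by rewrite -mulrN1 ascaleAl mulrN1. Qed.

Lemma qscaleE c x : qscale c (quot_pi x) = quot_pi (c *:: x).
Proof.
apply/quot_piP; rewrite -ascaleN -ascaleDr.
by apply: idealZ; apply: quot_reprB.
Qed.

Let elimq (u : quot) : {x | u = quot_pi x}.
Proof. by exists (repr u); rewrite /quot_pi reprK. Qed.

Fact qaddA : associative qadd.
Proof.
by move=> u v w; case: (elimq u) (elimq v) (elimq w) => [x ->] [y ->] [z ->];
  rewrite !qaddE addrA.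
Qed.
Fact qaddC : commutative qadd.
Proof.
by move=> u v; case: (elimq u) (elimq v) => [x ->] [y ->]; rewrite !qaddE addrC.
Qed.
Fact qadd0 : left_id (quot_pi 0) qadd.
Proof. by move=> u; case: (elimq u) => [x ->]; rewrite qaddE add0r. Qed.
Fact qaddN : left_inverse (quot_pi 0) qopp qadd.
Proof. by move=> u; case: (elimq u) => [x ->]; rewrite qoppE qaddE addNr. Qed.

HB.instance Definition _ := GRing.isZmodule.Build quot qaddA qaddC qadd0 qaddN.

Fact qmulA : associative qmul.
Proof.
by move=> u v w; case: (elimq u) (elimq v) (elimq w) => [x ->] [y ->] [z ->];
  rewrite !qmulE mulrA.
Qed.
Fact qmul1 : left_id (quot_pi 1) qmul.
Proof. by move=> u; case: (elimq u) => [x ->]; rewrite qmulE mul1r. Qed.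
Fact qmulr1 : right_id (quot_pi 1) qmul.
Proof. by move=> u; case: (elimq u) => [x ->]; rewrite qmulE mulr1. Qed.
Fact qmulDl : left_distributive qmul qadd.
Proof.
by move=> u v w; case: (elimq u) (elimq v) (elimq w) => [x ->] [y ->] [z ->];
  rewrite !(qmulE, qaddE) mulrDl.
Qed.
Fact qmulDr : right_distributive qmul qadd.
Proof.
by move=> u v w; case: (elimq u) (elimq v) (elimq w) => [x ->] [y ->] [z ->];
  rewrite !(qmulE, qaddE) mulrDr.
Qed.

HB.instance Definition _ :=
  GRing.Zmodule_isPzRing.Build quot qmulA qmul1 qmulr1 qmulDl qmulDr.

Fact qscaleA b c u : qscale b (qscale c u) = qscale (b * c) u.
Proof. by case: (elimq u) => [x ->]; rewrite !qscaleE ascaleA. Qed.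
Fact qscale1 u : qscale 1 u = u.
Proof. by case: (elimq u) => [x ->]; rewrite !qscaleE ascale1. Qed.
Fact qscaleDr c u v : qscale c (u + v) = qscale c u + qscale c v.
Proof.
case: (elimq u) (elimq v) => [x ->] [y ->].
by rewrite ![in LHS]/+%R ![in RHS]/+%R /= !(qaddE, qscaleE) ascaleDr.
Qed.
Fact qscaleDl b c u : qscale (b + c) u = qscale b u + qscale c u.
Proof.
case: (elimq u) => [x ->].
by rewrite [in RHS]/+%R /= !(qaddE, qscaleE) ascaleDl.
Qed.
Fact qscaleAl c (u v : quot) : qscale c (u * v) = qscale c u * v.
Proof.
case: (elimq u) (elimq v) => [x ->] [y ->].
by rewrite [in LHS]/*%R [in RHS]/*%R /= !(qmulE, qscaleE) ascaleAl.
Qed.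
Fact qscaleAr c (u v : quot) : qscale c (u * v) = u * qscale c v.
Proof.
case: (elimq u) (elimq v) => [x ->] [y ->].
by rewrite [in LHS]/*%R [in RHS]/*%R /= !(qmulE, qscaleE) ascaleAr.
Qed.

HB.instance Definition _ := isPzAlgebra.Build K quot
  qscaleA qscale1 qscaleDr qscaleDl qscaleAl qscaleAr.

Fact quot_pi_zmod : zmod_morphism quot_pi.
Proof. by move=> x y; rewrite -qaddE -qoppE. Qed.
Fact quot_pi_monoid : monoid_morphism quot_pi.
Proof. by split=> // x y; rewrite -qmulE. Qed.
Fact quot_piZ c x : quot_pi (c *:: x) = c *:: quot_pi x.
Proof. by rewrite -qscaleE. Qed.

HB.instance Definition _ := GRing.isZmodMorphism.Build A quot quot_pi quot_pi_zmod.
HB.instance Definition _ :=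
  GRing.isMonoidMorphism.Build A quot quot_pi quot_pi_monoid.
HB.instance Definition _ := isAlgScalable.Build K A quot quot_pi quot_piZ.

Lemma quot_pi0 x : quot_pi x = 0 <-> I x.
Proof. by rewrite -(raddf0 quot_pi) quot_piP subr0. Qed.

Definition quot_map (f : A -> A) (u : quot) : quot := quot_pi (f (repr u)).

Lemma quot_mapE (f : {linmap A -> A}) :
  (forall x, I x -> I (f x)) -> forall x, quot_map f (quot_pi x) = quot_pi (f x).
Proof. by move=> If x; apply/quot_piP; rewrite -raddfB; apply/If/quot_reprB. Qed.

Section QuotLin.
Variables (f : {linmap A -> A}) (If : forall x, I x -> I (f x)).

Fact quot_map_zmod : zmod_morphism (quot_map f).
Proof.
move=> u v; case: (elimq u) (elimq v) => [x ->] [y ->].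
by rewrite -raddfB !quot_mapE // !raddfB.
Qed.
Fact quot_mapZ c u : quot_map f (c *:: u) = c *:: quot_map f u.
Proof. by case: (elimq u) => [x ->]; rewrite -lhomZ !quot_mapE // !lhomZ. Qed.

Definition quot_lin : {linmap quot -> quot} :=
  HB.pack (quot_map f) (GRing.isZmodMorphism.Build _ _ _ quot_map_zmod)
    (isAlgScalable.Build _ _ _ _ quot_mapZ).

Lemma quot_linE x : quot_lin (quot_pi x) = quot_pi (f x).
Proof. exact: quot_mapE. Qed.

End QuotLin.

End QuotientAlgebra.

(* The grading is given by the projections [dpr n] onto the homogeneous
   components; [demb] identifies B with the component of degree 0. *)
Record diffAlg (K : pzRingType) (B : pzAlgType K) := DiffAlg {
  dcar :> pzAlgType K;
  dpr : nat -> {linmap dcar -> dcar};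
  demb : {alghom B -> dcar};
  dd : {linmap dcar -> dcar};
  dpr_pr : forall m n x, dpr m (dpr n x) = if m == n then dpr n x else 0;
  dpr_sum : forall x, exists N, x = \sum_(n < N) dpr n x;
  dpr_mul : forall m n x y,
    dpr m x = x -> dpr n y = y -> dpr (m + n) (x * y) = x * y;
  demb_inj : injective demb;
  demb_im : forall x, dpr 0 x = x <-> exists a, demb a = x;
  dd_deg : forall n x, dpr n x = x -> dpr n.+1 (dd x) = dd x;
  dd_leibniz : forall n x y, dpr n x = x ->
    dd (x * y) = dd x * y + (-1) ^+ n * (x * dd y);
  dd_dd : forall x, dd (dd x) = 0
}.

Definition is_calculus (K : pzRingType) (B : pzAlgType K) (G : diffAlg B) :=
  forall n (x : G), dpr G n x = x ->
    exists s : seq (B * n.-tuple B),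
      x = \sum_(p <- s) demb G p.1 * \prod_(a <- p.2) dd G (demb G a).

Record diffCalc (K : pzRingType) (B : pzAlgType K) := DiffCalc {
  calc_alg :> diffAlg B;
  calcP : is_calculus calc_alg
}.

(* Extensions of Psi to a homomorphism of differential algebras. *)
Record dhom (K : pzRingType) (A B : pzAlgType K) (Psi : {alghom A -> B})
    (GA : diffAlg A) (GB : diffAlg B) := DHom {
  dfun :> {alghom GA -> GB};
  dfun_deg : forall n x, dpr GA n x = x -> dpr GB n (dfun x) = dfun x;
  dfun_d : forall x, dfun (dd GA x) = dd GB (dfun x);
  dfun_emb : forall a, dfun (demb GA a) = demb GB (Psi a)
}.

Definition differentiable (K : pzRingType) (A B : pzAlgType K)
  (Psi : {alghom A -> B}) (GA : diffCalc A) (GB : diffCalc B) :=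
  inhabited (dhom Psi GA GB).

Record dideal (K : pzRingType) (B : pzAlgType K) (G : diffAlg B) := DIdeal {
  dideal_ideal :> ideal G;
  dideal_d : forall x, dideal_ideal x -> dideal_ideal (dd G x);
  dideal_pr : forall n x, dideal_ideal x -> dideal_ideal (dpr G n x)
}.

Definition deg0_trivial (K : pzRingType) (B : pzAlgType K) (G : diffAlg B)
  (J : dideal G) := forall x, J x -> dpr G 0 x = 0.

Section DiffAlgTheory.
Variables (K : pzRingType) (B : pzAlgType K) (G : diffAlg B).

Lemma dpr_id n (x : G) : dpr G n (dpr G n x) = dpr G n x.
Proof. by rewrite dpr_pr eqxx. Qed.

Lemma dpr_neq m n (x : G) : dpr G n x = x -> m != n -> dpr G m x = 0.
Proof. by move=> <- /negbTE mn; rewrite dpr_pr mn. Qed.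

Lemma dpr_sumW (x : G) N : x = \sum_(n < N) dpr G n x ->
  forall M, (N <= M)%N -> x = \sum_(n < M) dpr G n x.
Proof.
move=> xE M NM; rewrite [LHS]xE (big_ord_widen M (fun n => dpr G n x)) //.
rewrite big_mkcond; apply: eq_bigr => n _; case: ltnP => // Nn.
rewrite xE raddf_sum big1 //= => i _; rewrite dpr_pr gtn_eqF //.
exact: leq_trans Nn.
Qed.

Lemma dpr_emb n a : dpr G n (demb G a) = if n == 0%N then demb G a else 0.
Proof.
have h : dpr G 0 (demb G a) = demb G a by apply/demb_im; exists a.
by case: eqP => [->//|/eqP n0]; apply: dpr_neq h n0.
Qed.

Lemma dpr_d n x : dpr G n.+1 (dd G x) = dd G (dpr G n x).
Proof.
have [N xE] := dpr_sum x; have {}xE := dpr_sumW xE (leq_maxl N n.+1).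
rewrite {1}xE !raddf_sum /= (bigD1 (Ordinal (leq_maxr N n.+1))) //=.
rewrite dd_deg ?dpr_id // big1 ?addr0 // => i /eqP ni.
apply: (@dpr_neq _ i.+1); first by rewrite dd_deg ?dpr_id.
by apply/eqP => -[/esym h]; apply: ni; apply: val_inj.
Qed.

Lemma dpr_d0 x : dpr G 0 (dd G x) = 0.
Proof.
have [N {1}->] := dpr_sum x; rewrite !raddf_sum big1 //= => i _.
by apply: (@dpr_neq _ i.+1) => //; rewrite dd_deg ?dpr_id.
Qed.

Lemma dpr_prod n (x y : G) :
  dpr G n (x * y) = \sum_(i < n.+1) dpr G i x * dpr G (n - i) y.
Proof.
have [N xE] := dpr_sum x; have {}xE := dpr_sumW xE (leq_maxl N n.+1).
have [M yE] := dpr_sum y; have {}yE := dpr_sumW yE (leq_maxl M n.+1).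
set N' := maxn N _ in xE; set M' := maxn M _ in yE.
have hN : (n < N')%N by apply: leq_maxr.
have hM : (n < M')%N by apply: leq_maxr.
rewrite {1}xE {1}yE big_distrlr raddf_sum /=.
rewrite (big_ord_widen N' (fun i => dpr G i x * dpr G (n - i) y)) //.
rewrite [RHS]big_mkcond; apply: eq_bigr => i _; rewrite raddf_sum /=.
have hij (j : 'I_M') : dpr G (i + j) (dpr G i x * dpr G j y)
    = dpr G i x * dpr G j y by apply: dpr_mul; rewrite dpr_id.
rewrite ltnS; case: leqP => [le_in|lt_ni]; last first.
  rewrite big1 // => j _; apply: dpr_neq (hij j) _.
  by rewrite ltn_eqF // ltn_addr.
have lt_nM : (n - i < M')%N by apply: leq_ltn_trans hM; apply: leq_subr.
rewrite (bigD1 (Ordinal lt_nM)) //= -[in dpr G n](subnKC le_in).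
rewrite (hij (Ordinal lt_nM)) big1 ?addr0 // => j /eqP nj.
apply: dpr_neq (hij j) _; rewrite eqn_add2l; apply/eqP => h.
by apply: nj; apply: val_inj.
Qed.

Lemma dd_emb1 : dd G 1 = 0.
Proof.
have h : dpr G 0 (1 : G) = 1 by apply/demb_im; exists 1; rewrite rmorph1.
have := dd_leibniz 1 h; rewrite !mulr1 expr0 !mul1r => /eqP.
by rewrite addrC -subr_eq subrr eq_sym => /eqP.
Qed.

End DiffAlgTheory.

Section DHomTheory.
Variables (K : pzRingType) (A B : pzAlgType K) (Psi : {alghom A -> B}).
Variables (GA : diffAlg A) (GB : diffAlg B).

Lemma dfun_pr (f : dhom Psi GA GB) n x : f (dpr GA n x) = dpr GB n (f x).
Proof.
have [N xE] := dpr_sum x; have {}xE := dpr_sumW xE (leq_maxl N n.+1).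
rewrite [in RHS]xE !raddf_sum /= (bigD1 (Ordinal (leq_maxr N n.+1))) //=.
rewrite dfun_deg ?dpr_id // big1 ?addr0 // => i /eqP ni.
apply: (@dpr_neq _ _ _ _ i); first by rewrite dfun_deg ?dpr_id.
by apply/eqP => /esym h; apply: ni; apply: val_inj.
Qed.

Lemma dhom_unique (f g : dhom Psi GA GB) : is_calculus GA -> f =1 g.
Proof.
move=> GAc x; have [N ->] := dpr_sum x; rewrite !raddf_sum /=.
apply: eq_bigr => n _; have [s ->] := GAc n _ (dpr_id n x).
rewrite !raddf_sum /=; apply: eq_bigr => p _.
rewrite !rmorphM !rmorph_prod /= !dfun_emb; congr (_ * _).
by apply: eq_bigr => a _; rewrite !dfun_d !dfun_emb.
Qed.

Lemma dhom_surj (f : dhom Psi GA GB) : is_calculus GB ->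
  (forall b, exists a, Psi a = b) -> forall y, exists x, f x = y.
Proof.
move=> GBc Psis y.
have sumS (T : Type) (r : seq T) (F : T -> GB) :
    (forall t, exists x, f x = F t) -> exists x, f x = \sum_(t <- r) F t.
  move=> h; apply: (big_ind (fun z => exists x, f x = z)).
  - by exists 0; rewrite raddf0.
  - by move=> _ _ [x <-] [x' <-]; exists (x + x'); rewrite raddfD.
  - by move=> t _; apply: h.
have embS b : exists x, f x = demb GB b.
  by have [a <-] := Psis b; exists (demb GA a); rewrite dfun_emb.
have [N ->] := dpr_sum y; apply: (sumS) => n.
have [s ->] := GBc n _ (dpr_id n y); apply: sumS => p.
have [x0 <-] := embS p.1.
suff [x <-] : exists x, f x = \prod_(a <- p.2) dd GB (demb GB a).
  by exists (x0 * x); rewrite rmorphM.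
apply: (big_ind (fun z => exists x, f x = z)).
- by exists 1; rewrite rmorph1.
- by move=> _ _ [x <-] [x' <-]; exists (x * x'); rewrite rmorphM.
- by move=> b _; have [x <-] := embS b; exists (dd GA x); rewrite dfun_d.
Qed.

Section Image.
Variables (f : dhom Psi GA GB) (fs : forall y, exists x, f x = y).
Variable J : dideal GA.

Let fJ : GB -> Prop := f @` J.

Fact image0 : fJ 0.
Proof. by exists 0; [apply: ideal0|rewrite raddf0]. Qed.
Fact imageD x y : fJ x -> fJ y -> fJ (x + y).
Proof.
by move=> [u Ju <-] [v Jv <-]; exists (u + v); [apply: idealD|rewrite raddfD].
Qed.
Fact imageMl a x : fJ x -> fJ (a * x).
Proof.
move=> [u Ju <-]; have [b <-] := fs a.
by exists (b * u); [apply: idealMl|rewrite rmorphM].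
Qed.
Fact imageMr a x : fJ x -> fJ (x * a).
Proof.
move=> [u Ju <-]; have [b <-] := fs a.
by exists (u * b); [apply: idealMr|rewrite rmorphM].
Qed.
Fact image_d x : fJ x -> fJ (dd GB x).
Proof.
by move=> [u Ju <-]; exists (dd GA u); [apply: dideal_d|rewrite dfun_d].
Qed.
Fact image_pr n x : fJ x -> fJ (dpr GB n x).
Proof.
by move=> [u Ju <-]; exists (dpr GA n u); [apply: dideal_pr|rewrite dfun_pr].
Qed.

Definition image_dideal : dideal GB :=
  @DIdeal _ _ _ (Ideal image0 imageD imageMl imageMr) image_d image_pr.

Lemma image_deg0 : deg0_trivial J -> deg0_trivial image_dideal.
Proof. by move=> J0 _ [u Ju <-]; rewrite -dfun_pr J0 ?raddf0. Qed.

End Image.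
End DHomTheory.

Section QuotientCalculus.
Variables (K : pzRingType) (B : pzAlgType K) (G : diffCalc B).
Variables (J : dideal G) (J0 : deg0_trivial J).

Let Q : pzAlgType K := quot J.
Let q : {alghom G -> Q} := quot_pi J.
Let prQ n : {linmap Q -> Q} := quot_lin (@dideal_pr _ _ _ J n).
Let dQ : {linmap Q -> Q} := quot_lin (@dideal_d _ _ _ J).
Let embQ : {alghom B -> Q} := q \o demb G.

Let prE n x : prQ n (q x) = q (dpr G n x). Proof. exact: quot_linE. Qed.
Let dE x : dQ (q x) = q (dd G x). Proof. exact: quot_linE. Qed.
Let embE a : embQ a = q (demb G a). Proof. by []. Qed.
Let elimq (u : Q) : exists x, q x = u. Proof. exact: quot_surj. Qed.
Let elimh n u : prQ n u = u -> exists2 x, dpr G n x = x & q x = u.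
Proof.
by have [x <-] := elimq u; rewrite prE => <-; exists (dpr G n x); rewrite ?dpr_id.
Qed.

Fact quot_pr_pr m n u : prQ m (prQ n u) = if m == n then prQ n u else 0.
Proof. by have [x <-] := elimq u; rewrite !prE dpr_pr; case: ifP; rewrite ?raddf0. Qed.
Fact quot_pr_sum u : exists N, u = \sum_(n < N) prQ n u.
Proof.
have [x <-] := elimq u; have [N xE] := dpr_sum x; exists N.
by rewrite {1}xE raddf_sum; apply: eq_bigr => n _; rewrite prE.
Qed.
Fact quot_pr_mul m n u v :
  prQ m u = u -> prQ n v = v -> prQ (m + n) (u * v) = u * v.
Proof.
by move=> /elimh[x xh <-] /elimh[y yh <-]; rewrite -rmorphM prE dpr_mul.
Qed.
Fact quot_emb_inj : injective embQ.
Proof.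
move=> a b /quot_piP Jab; apply: (@demb_inj _ _ G); apply/eqP.
by rewrite -subr_eq0 -(J0 Jab) -raddfB dpr_emb.
Qed.
Fact quot_emb_im u : prQ 0 u = u <-> exists a, embQ a = u.
Proof.
split=> [/elimh[x /demb_im[a <-] <-]|[a <-]]; first by exists a.
by rewrite embE prE dpr_emb.
Qed.
Fact quot_d_deg n u : prQ n u = u -> prQ n.+1 (dQ u) = dQ u.
Proof. by move=> /elimh[x xh <-]; rewrite dE prE dd_deg. Qed.
Fact quot_d_leibniz n u v : prQ n u = u ->
  dQ (u * v) = dQ u * v + (-1) ^+ n * (u * dQ v).
Proof.
move=> /elimh[x xh <-]; have [y <-] := elimq v.
rewrite -rmorphM !dE (dd_leibniz _ xh) rmorphD !rmorphM rmorphXn /=.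
by rewrite rmorphN rmorph1.
Qed.
Fact quot_d_d u : dQ (dQ u) = 0.
Proof. by have [x <-] := elimq u; rewrite !dE dd_dd raddf0. Qed.

Definition quot_diffAlg : diffAlg B := DiffAlg quot_pr_pr quot_pr_sum
  quot_pr_mul quot_emb_inj quot_emb_im quot_d_deg quot_d_leibniz quot_d_d.

Fact quot_is_calculus : is_calculus quot_diffAlg.
Proof.
move=> n u /elimh[x /(@calcP _ _ G)[s ->] <-]; exists s.
rewrite (raddf_sum q); apply: eq_bigr => p _.
etransitivity; first exact: (rmorphM q).
rewrite (rmorph_prod q); congr (_ * _).
by apply: eq_bigr => a _; symmetry; apply: dE.
Qed.

Definition quot_calc : diffCalc B := DiffCalc quot_is_calculus.

End QuotientCalculus.

Arguments quot_calc {K B G} J J0.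

Section Spanned.
Variables (K : pzRingType) (B : pzAlgType K) (G : diffAlg B).

Definition spanned n (x : G) := exists s : seq (B * n.-tuple B),
  x = \sum_(p <- s) demb G p.1 * \prod_(a <- p.2) dd G (demb G a).

Lemma spanned0 n : spanned n 0.
Proof. by exists [::]; rewrite big_nil. Qed.

Lemma spannedD n x y : spanned n x -> spanned n y -> spanned n (x + y).
Proof. by move=> [s ->] [t ->]; exists (s ++ t); rewrite big_cat. Qed.

Lemma spanned_sum n (T : Type) (r : seq T) (F : T -> G) :
  (forall t, spanned n (F t)) -> spanned n (\sum_(t <- r) F t).
Proof.
move=> h; apply: (big_ind (spanned n)) => //; first exact: spanned0.
by move=> x y; apply: spannedD.
Qed.

Lemma spanned_gen n a (t : n.-tuple B) :
  spanned n (demb G a * \prod_(b <- t) dd G (demb G b)).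
Proof. by exists [:: (a, t)]; rewrite big_seq1. Qed.

Lemma spanned_embl n a x : spanned n x -> spanned n (demb G a * x).
Proof.
move=> [s ->]; rewrite mulr_sumr; apply: spanned_sum => p.
by rewrite mulrA -rmorphM; apply: spanned_gen.
Qed.

Lemma spanned_dr n x b : spanned n x -> spanned n.+1 (x * dd G (demb G b)).
Proof.
move=> [s ->]; rewrite mulr_suml; apply: spanned_sum => p.
exists [:: (p.1, [tuple of rcons p.2 b])].
by rewrite big_seq1 /= -cats1 big_cat big_seq1 mulrA.
Qed.

Lemma dd_emb_mul a x : dd G (demb G a * x) = dd G (demb G a) * x + demb G a * dd G x.
Proof. by rewrite (@dd_leibniz _ _ _ 0) ?dpr_emb // expr0 mul1r. Qed.

Lemma spanned_embr n x b : spanned n x -> spanned n (x * demb G b).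
Proof.
move=> [s ->]; rewrite mulr_suml; apply: spanned_sum => -[a [t tn]] /= {s}.
elim/last_ind: t => [|t c IHt] in n a b tn *.
  have n0 : n = 0%N by rewrite -(eqP tn).
  rewrite {tn}n0 big_nil mulr1 -rmorphM.
  by have := @spanned_gen 0 (a * b) [tuple]; rewrite big_nil mulr1.
have nE : n = (size t).+1 by rewrite -(eqP tn) size_rcons.
rewrite {tn}nE -cats1 big_cat big_seq1 /= mulrA -mulrA.
have -> : dd G (demb G c) * demb G b
    = dd G (demb G (c * b)) - demb G c * dd G (demb G b).
  by rewrite rmorphM dd_emb_mul addrK.
rewrite mulrBr; apply: spannedD.
  by apply: spanned_dr; apply: (@spanned_gen _ _ (in_tuple t)).
rewrite mulrA -mulNr -mulrN -rmorphN; apply: spanned_dr.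
exact: (IHt _ a (- c) (eqxx _)).
Qed.

Lemma spannedM m n x y : spanned m x -> spanned n y -> spanned (m + n) (x * y).
Proof.
move=> hx [s ->]; rewrite mulr_sumr; apply: spanned_sum => -[a [t tn]] /=.
rewrite mulrA; have := spanned_embr a hx.
move: (x * demb G a) => {a hx}x hx; rewrite {s} -(eqP tn) {n tn}.
elim: t => [|c t IHt] in m x hx *; first by rewrite big_nil mulr1 addn0.
by rewrite big_cons mulrA addnS -addSn; apply: IHt; apply: spanned_dr.
Qed.

Lemma dd_prod0 (t : seq B) : dd G (\prod_(b <- t) dd G (demb G b)) = 0.
Proof.
elim: t => [|c t IHt]; first by rewrite big_nil dd_emb1.
have hc : dpr G 1 (dd G (demb G c)) = dd G (demb G c) by rewrite dpr_d dpr_emb.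
by rewrite big_cons (dd_leibniz _ hc) dd_dd IHt mul0r !mulr0 addr0.
Qed.

Lemma spanned_d n x : spanned n x -> spanned n.+1 (dd G x).
Proof.
move=> [s ->]; rewrite raddf_sum; apply: spanned_sum => -[a t] /=.
rewrite dd_emb_mul dd_prod0 mulr0 addr0.
have := spanned_gen 1 [tuple of a :: t].
by rewrite big_cons rmorph1 mul1r.
Qed.

Lemma spannedZ n c x : spanned n x -> spanned n (c *:: x).
Proof.
by move=> hx; rewrite -[x]mul1r ascaleAl -(rmorph1 (demb G)) -lhomZ; apply: spanned_embl.
Qed.

End Spanned.

Section Bounded.
Variables (K : pzRingType) (B : pzAlgType K) (G : diffAlg B).

Definition bounded N (x : G) := x = \sum_(n < N) dpr G n x.

Lemma bounded_sum N (T : Type) (r : seq T) (F : T -> G) :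
  (forall t, bounded N (F t)) -> bounded N (\sum_(t <- r) F t).
Proof.
move=> h; apply: (big_ind (bounded N)) => //.
  by rewrite /bounded big1 // => i _; rewrite raddf0.
move=> x y hx hy; rewrite /bounded {1}hx {1}hy -big_split.
by apply: eq_bigr => i _; rewrite raddfD.
Qed.

Lemma bounded_homog N n x : dpr G n x = x -> (n < N)%N -> bounded N x.
Proof.
move=> hx nN; rewrite /bounded (bigD1 (Ordinal nN)) //= hx big1 ?addr0 //.
by move=> i /eqP ni; apply: dpr_neq hx _; apply/eqP => h; apply: ni; apply: val_inj.
Qed.

Lemma boundedM N M x y : bounded N x -> bounded M y -> bounded (N + M) (x * y).
Proof.
move=> -> ->; rewrite big_distrlr; apply: bounded_sum => i.
apply: bounded_sum => j; apply: (@bounded_homog _ (i + j)).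
  by apply: dpr_mul; rewrite dpr_id.
by rewrite -addSn leq_add // ltnW.
Qed.

Lemma bounded_d N x : bounded N x -> bounded N.+1 (dd G x).
Proof.
move=> ->; rewrite raddf_sum; apply: bounded_sum => i.
by apply: (@bounded_homog _ i.+1); rewrite ?ltnS //= dd_deg ?dpr_id.
Qed.

Lemma ascale_mul c (x : G) : c *:: x = (c *:: 1) * x.
Proof. by rewrite -ascaleAl mul1r. Qed.

Lemma bounded_scale N c x : bounded N x -> bounded N (c *:: x).
Proof.
rewrite /bounded => {1}->; rewrite ascale_mul mulr_sumr; apply: eq_bigr => i _.
by rewrite lhomZ -ascale_mul.
Qed.

End Bounded.

(* B itself, concentrated in degree 0, with d = 0. *)
Section TrivialDiffAlg.
Variables (K : pzRingType) (B : pzAlgType K).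

Definition tpr (n : nat) (x : B) : B := if n == 0%N then x else 0.
Definition td (x : B) : B := 0.

Lemma ascale0 c : c *:: (0 : B) = 0.
Proof. by apply: (addIr (c *:: 0)); rewrite -ascaleDr !add0r. Qed.

Fact tpr_zmod n : zmod_morphism (tpr n).
Proof. by move=> x y; rewrite /tpr; case: eqP; rewrite ?subrr. Qed.
Fact tprZ n c x : tpr n (c *:: x) = c *:: tpr n x.
Proof. by rewrite /tpr; case: eqP; rewrite ?ascale0. Qed.
HB.instance Definition _ n := GRing.isZmodMorphism.Build B B (tpr n) (tpr_zmod n).
HB.instance Definition _ n := isAlgScalable.Build K B B (tpr n) (tprZ n).
Fact td_zmod : zmod_morphism td.
Proof. by move=> x y; rewrite /td subrr. Qed.
Fact tdZ c x : td (c *:: x) = c *:: td x.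
Proof. by rewrite /td ascale0. Qed.
HB.instance Definition _ := GRing.isZmodMorphism.Build B B td td_zmod.
HB.instance Definition _ := isAlgScalable.Build K B B td tdZ.

Definition trivial_diffAlg : diffAlg B.
Proof.
apply: (@DiffAlg K B B tpr idfun td).
- by move=> [|m] [|n] x; rewrite /= /tpr //=; case: ifP.
- by move=> x; exists 1%N; rewrite big_ord1.
- move=> [|m] [|n] x y; rewrite /= /tpr //=.
  + by move=> _ <-; rewrite mulr0.
  + by move=> <-; rewrite mul0r.
  + by move=> <-; rewrite mul0r.
- by [].
- by move=> x; split=> // _; exists x.
- by [].
- by move=> n x y _; rewrite /= /td mul0r !mulr0 addr0.
- by [].
Defined.

End TrivialDiffAlg.

Section Omega.
Variables (K : pzRingType) (B : pzAlgType K).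

(* The universal differential calculus: formal differential expressions with
   coefficients in B, two of them being identified when they take the same value
   in every differential algebra G over every algebra A under B.  Its universal
   property is [Omega_universal] below. *)
Inductive expr :=
  | EEmb (a : B)
  | EAdd (e f : expr)
  | EMul (e f : expr)
  | EScale (c : K) (e : expr)
  | EPr (n : nat) (e : expr)
  | ED (e : expr).

HB.instance Definition _ := gen_eqMixin expr.
HB.instance Definition _ := gen_choiceMixin expr.

Fixpoint eval (A : pzAlgType K) (Psi : {alghom B -> A}) (G : diffAlg A)
    (e : expr) : G :=
  match e with
  | EEmb a => demb G (Psi a)
  | EAdd e f => eval Psi G e + eval Psi G f
  | EMul e f => eval Psi G e * eval Psi G f
  | EScale c e => c *:: eval Psi G e
  | EPr n e => dpr G n (eval Psi G e)
  | ED e => dd G (eval Psi G e)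
  end.

Definition expr_rel : rel expr := fun e f =>
  `[< forall (A : pzAlgType K) (Psi : {alghom B -> A}) (G : diffAlg A),
        eval Psi G e = eval Psi G f >].

Lemma expr_rel_equiv : equiv_class_of expr_rel.
Proof.
split=> [x|x y|y x z]; first by apply/asboolP.
- by apply: asbool_equiv_eq; split => h A Psi G.
- move=> /asboolP h1 /asboolP h2; apply/asboolP => A Psi G.
  by rewrite h1 h2.
Qed.

Canonical expr_equiv := EquivRelPack expr_rel_equiv.
Canonical expr_encModRel := defaultEncModRel expr_rel.

Definition Om := {eq_quot expr_rel}.
HB.instance Definition _ := Choice.on Om.
HB.instance Definition _ : EqQuotient expr expr_rel Om := EqQuotient.on Om.

Let q (e : expr) : Om := \pi_Om e.

Definition ev (A : pzAlgType K) (Psi : {alghom B -> A}) (G : diffAlg A)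
  (x : Om) : G := eval Psi G (repr x).

Lemma ev_pi (A : pzAlgType K) (Psi : {alghom B -> A}) (G : diffAlg A) e :
  ev Psi G (q e) = eval Psi G e.
Proof.
have /eqquotP/asboolP : \pi_Om (repr (q e)) = \pi_Om e by rewrite reprK.
exact.
Qed.

Lemma ev_ext (x y : Om) :
  (forall (A : pzAlgType K) (Psi : {alghom B -> A}) (G : diffAlg A),
     ev Psi G x = ev Psi G y) -> x = y.
Proof.
move=> h; rewrite -[x]reprK -[y]reprK; apply/eqquotP/asboolP => A Psi G.
exact: h.
Qed.

Definition oemb (a : B) : Om := q (EEmb a).
Definition oadd (x y : Om) : Om := q (EAdd (repr x) (repr y)).
Definition omul (x y : Om) : Om := q (EMul (repr x) (repr y)).
Definition oscale (c : K) (x : Om) : Om := q (EScale c (repr x)).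
Definition opr (n : nat) (x : Om) : Om := q (EPr n (repr x)).
Definition od (x : Om) : Om := q (ED (repr x)).
Definition oopp (x : Om) : Om := oscale (-1) x.

Section Ev.
Variables (A : pzAlgType K) (Psi : {alghom B -> A}) (G : diffAlg A).
Local Notation ev := (ev Psi G).

Lemma ev_emb a : ev (oemb a) = demb G (Psi a).
Proof. by rewrite ev_pi. Qed.
Lemma ev_add x y : ev (oadd x y) = ev x + ev y.
Proof. by rewrite ev_pi. Qed.
Lemma ev_mul x y : ev (omul x y) = ev x * ev y.
Proof. by rewrite ev_pi. Qed.
Lemma ev_scale c x : ev (oscale c x) = c *:: ev x.
Proof. by rewrite ev_pi. Qed.
Lemma ev_pr n x : ev (opr n x) = dpr G n (ev x).
Proof. by rewrite ev_pi. Qed.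
Lemma ev_d x : ev (od x) = dd G (ev x).
Proof. by rewrite ev_pi. Qed.
Lemma ev_opp x : ev (oopp x) = - ev x.
Proof.
have s0 : 0 *:: ev x = 0.
  by apply: (addIr (0 *:: ev x)); rewrite -ascaleDl !add0r.
rewrite ev_scale; apply: (addrI (ev x)).
by rewrite -{1}[ev x]ascale1 -ascaleDl !subrr.
Qed.
Lemma ev_0 : ev (oemb 0) = 0.
Proof. by rewrite ev_emb !raddf0. Qed.
Lemma ev_1 : ev (oemb 1) = 1.
Proof. by rewrite ev_emb !rmorph1. Qed.

Definition evE := (ev_0, ev_1, ev_emb, ev_opp, ev_add, ev_mul, ev_scale, ev_pr, ev_d).
End Ev.

Ltac by_ev := repeat intro; apply: ev_ext => A Psi G; rewrite !evE.

Fact oaddA : associative oadd. Proof. by by_ev; rewrite addrA. Qed.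
Fact oaddC : commutative oadd. Proof. by by_ev; rewrite addrC. Qed.
Fact oadd0 : left_id (oemb 0) oadd. Proof. by by_ev; rewrite add0r. Qed.
Fact oaddN : left_inverse (oemb 0) oopp oadd.
Proof. by by_ev; rewrite addNr. Qed.
HB.instance Definition _ := GRing.isZmodule.Build Om oaddA oaddC oadd0 oaddN.

Fact omulA : associative omul. Proof. by by_ev; rewrite mulrA. Qed.
Fact omul1 : left_id (oemb 1) omul. Proof. by by_ev; rewrite mul1r. Qed.
Fact omulr1 : right_id (oemb 1) omul. Proof. by by_ev; rewrite mulr1. Qed.
Fact omulDl : left_distributive omul oadd. Proof. by by_ev; rewrite mulrDl. Qed.
Fact omulDr : right_distributive omul oadd. Proof. by by_ev; rewrite mulrDr. Qed.
HB.instance Definition _ :=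
  GRing.Zmodule_isPzRing.Build Om omulA omul1 omulr1 omulDl omulDr.

Fact oscaleA b c x : oscale b (oscale c x) = oscale (b * c) x.
Proof. by by_ev; rewrite ascaleA. Qed.
Fact oscale1 x : oscale 1 x = x.
Proof. by by_ev; rewrite ascale1. Qed.
Fact oscaleDr c x y : oscale c (oadd x y) = oadd (oscale c x) (oscale c y).
Proof. by by_ev; rewrite ascaleDr. Qed.
Fact oscaleDl b c x : oscale (b + c) x = oadd (oscale b x) (oscale c x).
Proof. by by_ev; rewrite ascaleDl. Qed.
Fact oscaleAl c x y : oscale c (omul x y) = omul (oscale c x) y.
Proof. by by_ev; rewrite ascaleAl. Qed.
Fact oscaleAr c x y : oscale c (omul x y) = omul x (oscale c y).
Proof. by by_ev; rewrite ascaleAr. Qed.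
HB.instance Definition _ := isPzAlgebra.Build K Om
  oscaleA oscale1 oscaleDr oscaleDl oscaleAl oscaleAr.

Section EvHom.
Variables (A : pzAlgType K) (Psi : {alghom B -> A}) (G : diffAlg A).

Fact ev_zmod : zmod_morphism (ev Psi G).
Proof. by move=> x y; rewrite ev_add ev_opp. Qed.
Fact ev_monoid : monoid_morphism (ev Psi G).
Proof. by split=> [|x y]; [apply: ev_1|apply: ev_mul]. Qed.
HB.instance Definition _ := GRing.isZmodMorphism.Build Om G (ev Psi G) ev_zmod.
HB.instance Definition _ := GRing.isMonoidMorphism.Build Om G (ev Psi G) ev_monoid.
HB.instance Definition _ := isAlgScalable.Build K Om G (ev Psi G) (ev_scale Psi G).
End EvHom.

Fact oemb_zmod : zmod_morphism oemb.
Proof. by move=> a b; by_ev; rewrite !raddfB. Qed.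
Fact oemb_monoid : monoid_morphism oemb.
Proof. by split=> // a b; by_ev; rewrite !rmorphM. Qed.
Fact oembZ c a : oemb (c *:: a) = c *:: oemb a.
Proof. by by_ev; rewrite !lhomZ. Qed.
HB.instance Definition _ := GRing.isZmodMorphism.Build B Om oemb oemb_zmod.
HB.instance Definition _ := GRing.isMonoidMorphism.Build B Om oemb oemb_monoid.
HB.instance Definition _ := isAlgScalable.Build K B Om oemb oembZ.

Fact opr_zmod n : zmod_morphism (opr n).
Proof. by move=> x y; by_ev; rewrite raddfB. Qed.
Fact oprZ n c x : opr n (c *:: x) = c *:: opr n x.
Proof. by by_ev; rewrite lhomZ. Qed.
HB.instance Definition _ n := GRing.isZmodMorphism.Build Om Om (opr n) (opr_zmod n).
HB.instance Definition _ n := isAlgScalable.Build K Om Om (opr n) (oprZ n).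

Fact od_zmod : zmod_morphism od.
Proof. by move=> x y; by_ev; rewrite raddfB. Qed.
Fact odZ c x : od (c *:: x) = c *:: od x.
Proof. by by_ev; rewrite lhomZ. Qed.
HB.instance Definition _ := GRing.isZmodMorphism.Build Om Om od od_zmod.
HB.instance Definition _ := isAlgScalable.Build K Om Om od odZ.


Fact opr_pr m n (x : Om) : opr m (opr n x) = if m == n then opr n x else 0.
Proof. by case: eqP => [->|/eqP mn]; by_ev; rewrite dpr_pr ?eqxx // (negPf mn). Qed.

Fact expr_bounded e : exists N, forall (A : pzAlgType K)
  (Psi : {alghom B -> A}) (G : diffAlg A), bounded N (eval Psi G e).
Proof.
elim: e => [a|e [N hN] f [M hM]|e [N hN] f [M hM]|c e [N hN]|n e [N hN]|e [N hN]].
- by exists 1%N => A Psi G; rewrite /bounded big_ord1 dpr_emb.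
- exists (maxn N M) => A Psi G; rewrite /bounded /=.
  rewrite {1}(dpr_sumW (hN A Psi G) (leq_maxl N M)).
  rewrite {1}(dpr_sumW (hM A Psi G) (leq_maxr N M)) -big_split.
  by apply: eq_bigr => i _; rewrite raddfD.
- by exists (N + M)%N => A Psi G; apply: boundedM.
- by exists N => A Psi G; apply: bounded_scale.
- by exists n.+1 => A Psi G; apply: (@bounded_homog _ _ _ _ n); rewrite ?dpr_id.
- by exists N.+1 => A Psi G; apply: bounded_d.
Qed.

Fact opr_sum (x : Om) : exists N, x = \sum_(n < N) opr n x.
Proof.
have [N hN] := expr_bounded (repr x); exists N.
apply: ev_ext => A Psi G; rewrite raddf_sum; rewrite {1}/ev [LHS](hN A Psi G).
by apply: eq_bigr => n _; rewrite /= ev_pr.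
Qed.

Fact opr_mul m n (x y : Om) :
  opr m x = x -> opr n y = y -> opr (m + n) (x * y) = x * y.
Proof.
move=> hx hy; apply: ev_ext => A Psi G; rewrite ev_pr !ev_mul.
by apply: dpr_mul; [rewrite -ev_pr hx|rewrite -ev_pr hy].
Qed.

Fact oemb_inj : injective oemb.
Proof.
by move=> a b /(congr1 (ev idfun (trivial_diffAlg B))); rewrite !ev_emb.
Qed.

Fact expr_deg0 e : exists a, forall (A : pzAlgType K)
  (Psi : {alghom B -> A}) (G : diffAlg A),
  dpr G 0 (eval Psi G e) = demb G (Psi a).
Proof.
elim: e => [a|e [a ha] f [b hb]|e [a ha] f [b hb]|c e [a ha]|n e [a ha]|e _].
- by exists a => A Psi G; rewrite dpr_emb.
- by exists (a + b) => A Psi G; rewrite /= !raddfD /= ha hb.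
- by exists (a * b) => A Psi G; rewrite /= !rmorphM /= dpr_prod big_ord1 ha hb.
- by exists (c *:: a) => A Psi G; rewrite /= !lhomZ ha.
- case: n => [|n]; first by exists a => A Psi G; rewrite /= dpr_id ha.
  by exists 0 => A Psi G; rewrite /= dpr_pr /= !raddf0.
- by exists 0 => A Psi G; rewrite /= dpr_d0 !raddf0.
Qed.

Fact oemb_im (x : Om) : opr 0 x = x <-> exists a, oemb a = x.
Proof.
split=> [<-|[a <-]]; last by by_ev; rewrite dpr_emb.
have [a ha] := expr_deg0 (repr x); exists a.
by apply: ev_ext => A Psi G; rewrite !evE -ha.
Qed.

Fact od_deg n (x : Om) : opr n x = x -> opr n.+1 (od x) = od x.
Proof. by move=> hx; by_ev; rewrite dd_deg // -ev_pr hx. Qed.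

Fact od_leibniz n (x y : Om) : opr n x = x ->
  od (x * y) = od x * y + (-1) ^+ n * (x * od y).
Proof.
move=> hx; apply: ev_ext => A Psi G.
rewrite ev_d ev_mul (@dd_leibniz _ _ _ n) -?ev_pr ?hx //.
rewrite rmorphD !rmorphM rmorphXn /= rmorphN rmorph1.
by rewrite !ev_d.
Qed.

Fact od_d (x : Om) : od (od x) = 0.
Proof. by by_ev; rewrite dd_dd. Qed.

Definition Omega_alg : diffAlg B := DiffAlg opr_pr opr_sum opr_mul
  oemb_inj oemb_im od_deg od_leibniz od_d.

Lemma q_add e f : q (EAdd e f) = oadd (q e) (q f).
Proof. by apply: ev_ext => A Psi G; rewrite !evE !ev_pi. Qed.
Lemma q_mul e f : q (EMul e f) = omul (q e) (q f).
Proof. by apply: ev_ext => A Psi G; rewrite !evE !ev_pi. Qed.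
Lemma q_scale c e : q (EScale c e) = oscale c (q e).
Proof. by apply: ev_ext => A Psi G; rewrite !evE !ev_pi. Qed.
Lemma q_pr n e : q (EPr n e) = opr n (q e).
Proof. by apply: ev_ext => A Psi G; rewrite !evE !ev_pi. Qed.
Lemma q_d e : q (ED e) = od (q e).
Proof. by apply: ev_ext => A Psi G; rewrite !evE !ev_pi. Qed.

Fact Omega_is_calculus : is_calculus Omega_alg.
Proof.
suff h e n : spanned n (dpr Omega_alg n (q e)).
  by move=> n x <-; rewrite -[x]reprK; apply: h.
elim: e n => [a|e he f hf|e he f hf|c e he|m e he|e he] n.
- rewrite (dpr_emb Omega_alg n a); case: eqP => [->|_]; last exact: spanned0.
  by have := @spanned_gen _ _ Omega_alg 0 a [tuple]; rewrite big_nil mulr1.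
- by rewrite q_add raddfD; apply: spannedD.
- rewrite q_mul (dpr_prod (G := Omega_alg)); apply: spanned_sum => i.
  by have := leq_ord i; move: (i : nat) => j jn; rewrite -[n in spanned n](subnKC jn); apply: spannedM.
- by rewrite q_scale lhomZ; apply: spannedZ.
- by rewrite q_pr dpr_pr; case: eqP => [->|_]; [apply: he|apply: spanned0].
- rewrite q_d; case: n => [|n]; first by rewrite dpr_d0; apply: spanned0.
  by rewrite dpr_d; apply: spanned_d.
Qed.

Definition Omega : diffCalc B := DiffCalc Omega_is_calculus.

Section Lift.
Variables (A : pzAlgType K) (Psi : {alghom B -> A}) (G : diffAlg A).

Fact lift_deg n (x : Omega) : dpr Omega n x = x -> dpr G n (ev Psi G x) = ev Psi G x.
Proof. by move=> hx; rewrite -ev_pr; congr (ev Psi G _). Qed.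

Definition Omega_lift : dhom Psi Omega G :=
  @DHom K B A Psi Omega G (ev Psi G : {alghom Om -> G}) lift_deg (ev_d Psi G) (ev_emb Psi G).

Theorem Omega_universal :
  exists f : dhom Psi Omega G, forall g : dhom Psi Omega G, g =1 f.
Proof. by exists Omega_lift => g; apply/dhom_unique/calcP. Qed.

End Lift.
End Omega.

Section Adapted.
Variables (K : pzRingType).

Definition Omega_map (A B : pzAlgType K) (Psi : {alghom A -> B}) :
  dhom Psi (Omega A) (Omega B) := Omega_lift Psi (Omega B).

Lemma Omega_map_surj (A B : pzAlgType K) (Psi : {alghom A -> B}) :
  (forall b, exists a, Psi a = b) -> forall y, exists x, Omega_map Psi x = y.
Proof. by apply: dhom_surj; apply: calcP. Qed.

Definition dker (A B : pzAlgType K) (Psi : {alghom A -> B}) (GA : diffAlg A)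
  (GB : diffAlg B) (f : dhom Psi GA GB) : set GA := [set x | f x = 0].

Variables (B : pzAlgType K) (I : finType) (J : I -> ideal B).

Definition covering := \bigcap_(i in [set: I]) (J i : set B) = [set 0].

(* The extensions [piG i] of [quot_pi (J i)] are unique, by [dhom_unique]. *)
Definition adapted (G : diffCalc B) (Gi : forall i, diffCalc (quot (J i))) :=
  (forall i, differentiable (quot_pi (J i)) G (Gi i)) /\
  (forall piG : forall i, dhom (quot_pi (J i)) G (Gi i),
     \bigcap_(i in [set: I]) dker (piG i) = [set 0]).

Definition local_dideal (JB : dideal (Omega B)) (i : I) :
    dideal (Omega (quot (J i))) :=
  image_dideal (Omega_map_surj (@quot_surj _ _ (J i))) JB.

Lemma local_deg0 (JB : dideal (Omega B)) (i : I) :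
  deg0_trivial JB -> deg0_trivial (local_dideal JB i).
Proof. exact: image_deg0. Qed.

End Adapted.

Arguments adapted {K B I} J G Gi.
Arguments local_deg0 {K B I} J {JB} i _.

(* Main.v *)
(* Uniqueness of extensions identifies each [pi_i] on the quotient calculi with
   the map induced by [pi_i] on the universal ones, so the class of [x] is in
   its kernel iff [pi_i x] is in [pi_i (J B)], that is, iff
   [x] is in [J B + ker pi_i].  Adaptedness says that an [x] lying in all these
   sets is already in [J B]; the other inclusion always holds. *)

Require Import Defs.
From HB Require Import structures.
From mathcomp Require Import all_boot all_algebra.
From mathcomp Require Import boolp classical_sets reals.
From mathcomp Require Import complex.

Set Implicit Arguments.
Unset Strict Implicit.
Unset Printing Implicit Defensive.
Import GRing.Theory.
Local Open Scope ring_scope.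
Local Open Scope classical_set_scope.

Section QuotientAlgHom.
Variables (K : pzRingType) (A B : pzAlgType K) (I : ideal A) (I' : ideal B).
Variables (f : {alghom A -> B}) (fI : forall x, I x -> I' (f x)).

Definition quot_hom (u : quot I) : quot I' := quot_pi I' (f (repr u)).

(** The choice of [repr] does not matter: two representatives differ by an element of [I], which [f]
    sends into [I']. *)
Lemma quot_homE x : quot_hom (quot_pi I x) = quot_pi I' (f x).
Proof. by apply/quot_piP; rewrite -raddfB; apply/fI/quot_reprB. Qed.

Fact quot_hom_zmod : zmod_morphism quot_hom.
Proof.
move=> u v; have [x <-] := quot_surj u; have [y <-] := quot_surj v.
by rewrite -raddfB !quot_homE -!raddfB.
Qed.

Fact quot_hom_monoid : monoid_morphism quot_hom.
Proof.
split=> [|u v].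
  by rewrite -(rmorph1 (quot_pi I)) quot_homE !rmorph1.
have [x <-] := quot_surj u; have [y <-] := quot_surj v.
by rewrite -rmorphM !quot_homE !rmorphM.
Qed.

Fact quot_homZ c u : quot_hom (c *:: u) = c *:: quot_hom u.
Proof. by have [x <-] := quot_surj u; rewrite -lhomZ !quot_homE !lhomZ. Qed.

Definition quot_alghom : {alghom quot I -> quot I'} :=
  HB.pack quot_hom (GRing.isZmodMorphism.Build _ _ _ quot_hom_zmod)
    (GRing.isMonoidMorphism.Build _ _ _ quot_hom_monoid)
    (isAlgScalable.Build _ _ _ _ quot_homZ).

End QuotientAlgHom.

Section QuotientCalculusPi.
Variables (K : pzRingType) (B : pzAlgType K) (G : diffCalc B).
Variables (J : dideal G) (J0 : deg0_trivial J).

Lemma quot_calc_pr n (x : G) :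
  dpr (quot_calc J J0) n (quot_pi J x) = quot_pi J (dpr G n x).
Proof. exact: quot_linE. Qed.

Lemma quot_calc_d (x : G) :
  dd (quot_calc J J0) (quot_pi J x) = quot_pi J (dd G x).
Proof. exact: quot_linE. Qed.

End QuotientCalculusPi.

Section QuotientDHom.
Variables (K : pzRingType) (A B : pzAlgType K) (Psi : {alghom A -> B}).
Variables (GA : diffCalc A) (GB : diffCalc B) (f : dhom Psi GA GB).
Variables (J : dideal GA) (J0 : deg0_trivial J).
Variables (J' : dideal GB) (J'0 : deg0_trivial J').
Variable fJ : forall x, J x -> J' (f x).

Let F := quot_alghom fJ.
Let FE x : F (quot_pi J x) = quot_pi J' (f x). Proof. exact: quot_homE. Qed.

(** Treating all [u], not only homogeneous ones, avoids choosing a homogeneous representative;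
    preservation of degree then follows at once. *)
Fact quot_dhom_pr n u :
  F (dpr (quot_calc J J0) n u) = dpr (quot_calc J' J'0) n (F u).
Proof.
have [x <-] := quot_surj u.
by rewrite (quot_calc_pr J0) !FE dfun_pr (quot_calc_pr J'0).
Qed.

Fact quot_dhom_deg n u : dpr (quot_calc J J0) n u = u ->
  dpr (quot_calc J' J'0) n (F u) = F u.
Proof. by move=> uE; rewrite -quot_dhom_pr uE. Qed.

Fact quot_dhom_d u :
  F (dd (quot_calc J J0) u) = dd (quot_calc J' J'0) (F u).
Proof.
have [x <-] := quot_surj u.
by rewrite (quot_calc_d J0) !FE dfun_d (quot_calc_d J'0).
Qed.

Fact quot_dhom_emb a :
  F (demb (quot_calc J J0) a) = demb (quot_calc J' J'0) (Psi a).
Proof. by rewrite FE dfun_emb. Qed.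

Definition quot_dhom : dhom Psi (quot_calc J J0) (quot_calc J' J'0) :=
  @DHom _ _ _ Psi (quot_calc J J0) (quot_calc J' J'0) F
    quot_dhom_deg quot_dhom_d quot_dhom_emb.

(** The extension [g] is arbitrary, but a homomorphism out of a calculus is determined by [Psi], so
    [g] agrees with [quot_dhom], whose value on a class is explicit. *)
Lemma quot_dhom_ker (g : dhom Psi (quot_calc J J0) (quot_calc J' J'0)) x :
  dker g (quot_pi J x) <-> J' (f x).
Proof.
rewrite /dker /= (dhom_unique g quot_dhom (@calcP _ _ _)) /=.
by rewrite (quot_homE fJ) quot_pi0.
Qed.

End QuotientDHom.

(** If [f x = f y] with [y] in [J], then [x - y] lies in the kernel and [x = y + (x - y)]. *)
Lemma image_idealP (K : pzRingType) (A B : pzAlgType K)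
    (Psi : {alghom A -> B}) (GA : diffAlg A) (GB : diffAlg B)
    (f : dhom Psi GA GB) (J : dideal GA) x :
  (f @` (J : set GA)) (f x) <->
    [set y + z | y in (J : set GA) & z in dker f] x.
Proof.
split=> [[y Jy fyx]|[y Jy [z fz <-]]].
  exists y => //; exists (x - y); last by rewrite addrC subrK.
  by rewrite /dker /= raddfB /= fyx subrr.
by exists y => //; rewrite raddfD /= fz addr0.
Qed.

Theorem proposition12 (R : realType) (B : pzAlgType R[i])
    (JB : dideal (Omega B)) (JB0 : deg0_trivial JB)
    (I : finType) (J : I -> ideal B) (hJ : covering J) :
  adapted J (quot_calc JB JB0)
    (fun i => quot_calc (local_dideal J JB i) (local_deg0 J i JB0))
  <->
  (JB : set (Omega B)) =
    \bigcap_(i in [set: I])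
      [set x + y | x in (JB : set (Omega B)) &
                   y in dker (Omega_map (quot_pi (J i)))].
Proof.
have fJ i x : JB x -> local_dideal J JB i (Omega_map (quot_pi (J i)) x).
  by move=> JBx; exists x.
pose pq i := quot_dhom JB0 (local_deg0 J i JB0) (fJ i).
(* Adaptedness concerns every family of extensions; for the forward direction the induced family
   [pq] suffices. *)
split=> [[_ /(_ pq) kerE]|JBE].
  apply/seteqP; split=> x.
    by move=> JBx i _; apply/image_idealP/fJ.
  move=> xJ; apply/(quot_pi0 JB).
  (* Membership of [x] in [JB] means that its class is zero, so it is enough to place this class in
     every kernel. *)
  have : [set (0 : quot_calc JB JB0)] (quot_pi JB x); last by [].
  rewrite -kerE => i _; apply/(quot_dhom_ker (fJ i))/image_idealP.
  exact: xJ.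
(* Differentiability is witnessed by [pq] and does not depend on [JBE]. *)
split=> [i|g]; first by split; apply: pq.
apply/seteqP; split=> [u uker|_ -> i _]; last by rewrite /dker /= raddf0.
have [x xu] := quot_surj u; rewrite -xu in uker *.
(* The [change] displays [JB] as a set, the form in which [JBE] can rewrite it. *)
apply/quot_pi0; change ((JB : set (Omega B)) x); rewrite JBE => i iT.
apply/image_idealP; apply/(quot_dhom_ker (fJ i) (g i)); exact: uker.
Qed.
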